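(* Let $\mathcal X$ be a symmetrically normed ideal of compact operators on a Hilbert space $\mathcal H$, and let $$\Vert T\Vert_{\mathcal X}\asymp\Big\Vert\Big\{\sum_{j=1}^ns_j(T)\Big\}_n\Big\Vert_F,$$ where $F$ is a Banach sequence lattice such that the operator $S(\{a_n\}):=\{a_{n^2}\}$ is bounded on $F$. Then $$\Vert T\Vert_{\mathcal X}\asymp\Big\Vert\{\Vert T\Vert_{p(n)}\}_n\Big\Vert_F,\qquad p(n)=\frac{2\log(en)}{2\log(en)-1},\ n\in\mathbb N,$$ where $\Vert T\Vert_{p(n)}$ are the corresponding Schatten–von Neumann norms of $T$.
   Context: $\mathcal H$ is a separable complex Hilbert space. For a compact operator $T$ on $\mathcal H$, $\{s_j(T)\}_{j\ge1}$ is the non-increasing sequence of its $s$-numbers (singular values), and $\Vert T\Vert_p=\Vert T\Vert_{\mathfrak S^p}=(\sum_js_j(T)^p)^{1/p}$ is its Schatten–von Neumann norm. A Banach sequence lattice $F$ is a Banach lattice of sequences indexed by $n\in\mathbb N=\{1,2,\dots\}$ with coordinatewise order. A symmetrically normed ideal is a two-sided ideal of compact operators that is a Banach space under a norm depending only on the $s$-numbers (and symmetric in the sense of Gohberg–Krein). $\asymp$ means two-sided inequality with positive constants independent of $T$. *)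

(* Defs.v *)
From HB Require Import structures.
From mathcomp Require Import all_boot all_order all_algebra.
From mathcomp Require Import sesquilinear complex.
From mathcomp Require Import all_classical all_reals all_analysis.

Set Implicit Arguments.
Unset Strict Implicit.
Unset Printing Implicit Defensive.

Import Order.TTheory GRing.Theory Num.Theory.
Import numFieldNormedType.Exports.

Local Open Scope classical_set_scope.
Local Open Scope ring_scope.
Local Open Scope complex_scope.

(* All sequences are indexed from 0: the term with index n of a Rocq sequence
   is the term with index n + 1 of the mathematical one. *)

Definition separable (T : topologicalType) : Prop :=
  exists2 D : set T, countable D & dense D.

(* The norm of a normed module over R[i] takes values in R[i]; they are
   nonnegative reals, and rnorm is the same norm with values in R. *)
Definition rnorm (R : realType) (V : normedModType R[i]) (x : V) : R :=
  complex.Re `|x|.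

Section Operators.
Context {R : realType} {H : completeNormedModType R[i]}.
Implicit Types T A : H -> H.

Definition bounded_op T : Prop := linear T /\ continuous T.

Definition compact_op T : Prop :=
  bounded_op T /\ precompact (T @` [set x | `|x| <= 1]).

Definition opnorm A : R := sup [set rnorm (A x) | x in [set x : H | `|x| <= 1]].

(* The inner product ip u v is linear in u and conjugate-linear in v. *)
Variable ip : {dot H for Num.conj}.

(* The set has exactly one element when T is bounded and H is a Hilbert space
   for ip. *)
Definition adjoint T : H -> H :=
  xget (fun=> 0) [set S : H -> H | forall u v, ip (T u) v = ip u (S v)].

Definition orthonormal_family n (v : 'I_n -> H) : Prop :=
  forall i k, ip (v i) (v k) = (i == k)%:R.

(* v is an eigenvector of T^* T (or 0) for the eigenvalue l ^ 2. *)
Definition sing_vector T (l : R) (v : H) : Prop :=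
  adjoint T (T v) = (l ^+ 2)%:C *: v.

(* The s-numbers are the nonnegative square roots of the eigenvalues of T^* T,
   listed in non-increasing order and with multiplicity. The number of those
   that are >= t is the maximal length of an orthonormal family of
   corresponding eigenvectors, so the term with index j of the list (index
   j + 1 when counting from 1) is the largest t for which this number is
   at least j + 1. The set is empty, and its sup 0, when dim H <= j. *)
Definition snum T (j : nat) : R :=
  sup [set t : R | 0 <= t /\ exists v : 'I_j.+1 -> H,
    orthonormal_family v /\
    forall i, exists2 l : R, t <= l & sing_vector T l (v i)].

(* +oo when T is not in the Schatten-von Neumann class. *)
Definition schatten (p : R) T : \bar R :=
  poweR (\sum_(0 <= j <oo) ((snum T j) `^ p)%:E)%E p^-1.

End Operators.

(* A symmetrically normed ideal, given as a complex Banach space X with a linear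
   injection sni_op into the operators. sni_rank1 and the estimate in sni_ideal
   are the two symmetry axioms of Gohberg and Krein. *)
Record snIdeal (R : realType) (H : completeNormedModType R[i])
    (ip : {dot H for Num.conj}) := SNIdeal {
  sni_space :> completeNormedModType R[i] ;
  sni_op : {linear sni_space -> (H -> H)} ;
  sni_inj : injective sni_op ;
  sni_compact : forall x, compact_op (sni_op x) ;
  sni_ideal : forall (A B : H -> H) (x : sni_space),
    bounded_op A -> bounded_op B ->
    exists2 y : sni_space, sni_op y = A \o sni_op x \o B &
      rnorm y <= opnorm A * rnorm x * opnorm B ;
  sni_rank1 : forall (x : sni_space) (a b : H),
    sni_op x = (fun u => ip u a *: b) -> rnorm x = opnorm (sni_op x) ;
  sni_snum : forall x y : sni_space,
    snum ip (sni_op x) =1 snum ip (sni_op y) -> rnorm x = rnorm y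
}.

(* +oo when T does not belong to X; otherwise the infimum is over one value. *)
Definition sni_norm (R : realType) (H : completeNormedModType R[i])
    (ip : {dot H for Num.conj}) (X : snIdeal ip) (T : H -> H) : \bar R :=
  ereal_inf [set (rnorm x)%:E | x in [set x : X | sni_op X x = T]].

(* A Banach space of real sequences which is an order ideal in the lattice of
   all sequences and whose norm is monotone for the coordinatewise order. *)
Record banachSeqLattice (R : realType) := BanachSeqLattice {
  bsl_space :> completeNormedModType R ;
  coord : {linear bsl_space -> (nat -> R^o)} ;
  coord_inj : injective coord ;
  bsl_solid : forall (f : bsl_space) (a : nat -> R),
    (forall n, `|a n| <= `|coord f n|) ->
    exists2 g : bsl_space, coord g = a & `|g| <= `|f|
}.

(* +oo when a has an infinite term or does not belong to F; otherwise the
   infimum is over one value. *)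
Definition bsl_norm (R : realType) (F : banachSeqLattice R)
    (a : nat -> \bar R) : \bar R :=
  ereal_inf [set `|f|%:E | f in [set f : F | forall n, (coord F f n)%:E = a n]].

(* The operator {a_n} |-> {a_(n^2)}, in the indexing from 0. *)
Definition square_dilation (V : Type) (a : nat -> V) : nat -> V :=
  fun n => a (n.+1 ^ 2).-1.

Definition square_dilation_bounded (R : realType) (F : banachSeqLattice R) :=
  exists C : R, forall f : F,
    exists2 g : F, coord F g = square_dilation (coord F f) &
      `|g| <= C * `|f|.

(* Sum of the n + 1 largest s-numbers. *)
Definition snum_sum (R : realType) (H : completeNormedModType R[i])
    (ip : {dot H for Num.conj}) (T : H -> H) (n : nat) : R :=
  \sum_(j < n.+1) snum ip T j.

(* The exponent p(n + 1) = 2 log(e(n + 1)) / (2 log(e(n + 1)) - 1). *)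
Definition pexp (R : realType) (n : nat) : R :=
  2 * ln (expR 1 * n.+1%:R) / (2 * ln (expR 1 * n.+1%:R) - 1).

(* f is equivalent to g on D, with constants independent of T in D. *)
Definition equiv_on (R : realType) (U : Type) (D : set U) (f g : U -> \bar R) :=
  exists c C : R, [/\ 0 < c, 0 < C & forall T, D T ->
    (c%:E * g T <= f T)%E /\ (f T <= C%:E * g T)%E].

(* Main.v *)
Require Import Defs.
From HB Require Import structures.
From mathcomp Require Import all_boot all_order all_algebra.
From mathcomp Require Import sesquilinear complex.
From mathcomp Require Import all_classical all_reals all_analysis.
From mathcomp Require Import ring lra.
Import Order.TTheory GRing.Theory Num.Theory.
Import numFieldNormedType.Exports.
Local Open Scope classical_set_scope.
Local Open Scope ring_scope.

(* Only the monotonicity of the s-numbers matters. Write A k for the sum of the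
   first n^(2^k) s-numbers and p for p(n), so that p - 1 = 1 / (1 + 2 log n).
   Convexity gives A 0 <= n^(1 - 1/p) ||T||_p <= e ||T||_p. Conversely, on the
   block n^(2^k) <= j < n^(2^(k+1)) one has s_j <= A (k+1) / n^(2^k), whence
   the p-norm of the block is at most exp(-2^k / 8) A (k+1), and
   ||T||_p <= A 0 + sum_k exp(-2^k / 8) A (k+1). As functions of n the A k are
   the images of A 0 under the iterates S^k, whose norms grow at most
   exponentially in k, so that the series converges in F. This is for n >= 2;
   for n = 1 the blocks degenerate, and ||T||_(p(1)) is bounded with the base 2
   instead. *)

(** * Bounded operators and monotonicity of the s-numbers *)

Lemma bounded_op_le (R : realType) (H : completeNormedModType R[i])
    (T : H -> H) : bounded_op T ->
  exists2 M : R, 0 <= M & forall x, `|T x| <= (M%:C)%C * `|x|.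
Proof.
move=> [Tl Tc].
pose LT := GRing.isLinear.Build _ _ _ _ T Tl.
pose f : {linear H -> H} := HB.pack T LT.
have /linear_boundedP : bounded_near f (nbhs 0).
  by apply: continuous_linear_bounded; exact: Tc.
move=> /pinfty_ex_gt0 [r r0 Hr].
(* A positive element of [R[i]] has zero imaginary part. *)
have rE : r = ((complex.Re r)%:C)%C.
  by move: r0; rewrite ltcE /= => /andP[/eqP]; case: r {Hr} => a b /= -> _.
exists (complex.Re r); last by move=> x; rewrite -rE; exact: Hr.
by move: r0; rewrite ltcE /= => /andP[_ /ltW].
Qed.

Section SNumbers.
Context {R : realType} {H : completeNormedModType R[i]}.
Variable ip : {dot H for Num.conj}.
Hypothesis ip_norm : forall x : H, `|x| ^+ 2 = ip x x.
Implicit Types T : H -> H.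

(* If T had no adjoint, then [adjoint ip T] would be 0 by convention and the
   bound would hold with l = 0. *)
Lemma sing_vector_le T (M l : R) (v : H) :
  0 <= M -> (forall x, `|T x| <= (M%:C)%C * `|x|) ->
  0 <= l -> ip v v = 1 -> sing_vector ip T l v -> l <= M.
Proof.
move=> M0 TM l0 v1; rewrite /sing_vector => Tv.
have nv : `|v| = 1.
  by apply/eqP; rewrite -(@eqrXn2 _ 2) // ip_norm v1 expr1n.
have lC0 : (0 : R[i]) <= (l%:C)%C by rewrite lecE /= eqxx.
have MC0 : (0 : R[i]) <= (M%:C)%C by rewrite lecE /= eqxx.
suff : ((l ^+ 2)%:C)%C <= `|T v| ^+ 2.
  rewrite rmorphXn /= ler_pXn2r ?nnegrE // => /le_trans/(_ (TM v)).
  by rewrite nv mulr1 lecE /= => /andP[].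
have [[S TS]|noS] := pselect (exists S : H -> H,
    forall u w, ip (T u) w = ip u (S w)).
  have adjP : forall u w, ip (T u) w = ip u (adjoint ip T w).
    exact: (@xgetPex _ (fun=> 0)
      [set S : H -> H | forall u w, ip (T u) w = ip u (S w)] (ex_intro _ S TS)).
  rewrite ip_norm adjP Tv linearZr_LR /= v1 mulr1.
  by rewrite conj_Creal //= complex_real.
have : (l ^+ 2)%:C%C *: v = 0.
  rewrite -Tv /adjoint xgetPN // => S TS.
  by apply: noS; exists S.
move/(congr1 Num.norm); rewrite normr0 normrZ nv mulr1 => /eqP.
by rewrite normr_eq0 => /eqP ->; rewrite exprn_ge0.
Qed.

Lemma snum_ge0 T j : 0 <= snum ip T j.
Proof.
rewrite /snum; set E := [set t | _].
have [Es|noEs] := pselect (has_sup E); last by rewrite sup_out.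
by case: (Es) => -[t Et] Eb; apply: le_trans (Et.1) (ub_le_sup Eb Et).
Qed.

(** Truncating orthonormal families embeds the set defining the term [j] into the one for [i].
    Boundedness of [T] bounds both sets above; otherwise [sup] could fall back to its default 0. *)
Lemma snum_nonincreasing T : bounded_op T ->
  {homo snum ip T : i j / (i <= j)%N >-> j <= i}.
Proof.
move=> /bounded_op_le[M M0 TM] i j ij.
rewrite {1}/snum; set E := [set t | _].
have [->|/set0P E0] := eqVneq E set0; first by rewrite sup0 snum_ge0.
have subE : E `<=` [set t | 0 <= t /\ exists v : 'I_i.+1 -> H,
    orthonormal_family ip v /\
    forall k, exists2 l : R, t <= l & sing_vector ip T l (v k)].
  move=> t [t0 [v [vo vs]]]; split => //.
  exists (v \o widen_ord (ij : (i.+1 <= j.+1)%N)); split => [k l|k].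
    by rewrite /= vo; congr (_%:R).
  exact: vs.
apply: sup_le => //.
  by move=> t /subE Et; exists t.
split; first by case: E0 => t /subE; exists t.
exists M => t [t0 [v [vo vs]]].
have [l tl lv] := vs ord0; apply: (le_trans tl).
apply: sing_vector_le M0 TM _ _ lv; first exact: (le_trans t0 tl).
by rewrite vo eqxx.
Qed.

End SNumbers.

(** * Partial sums, p-norms and block decomposition *)

Section SequenceNorms.
Context {R : realType}.
Implicit Types (s : nat -> R) (p M : R).

(** Tangent of the convex function t^p at 1, obtained from Young's inequality for the product of t
    and 1. *)
Lemma powR_ge_tangent (t p : R) : 0 <= t -> 1 < p -> p * t - (p - 1) <= t `^ p.
Proof.
move=> t0 p1; have p0 : 0 < p by lra.
have q0 : 0 < p / (p - 1) by rewrite divr_gt0 // subr_gt0.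
have pq : p^-1 + (p / (p - 1))^-1 = 1 by field; rewrite !gt_eqF // subr_gt0.
have := @conjugate_powR _ t 1 p _ t0 ler01 p0 q0 pq.
rewrite mulr1 powR1 -(ler_pM2l p0) mulrDr mulrCA divff ?gt_eqF // mulr1.
by rewrite mul1r invf_div mulrCA divff ?gt_eqF // mulr1 lerBlDr.
Qed.

(** Jensen's inequality: the tangent bounds at the mean [mu] are summed, where the ratios [s j / mu]
    add up to [n]. *)
Lemma powR_sum_le s p n : (forall j, 0 <= s j) -> 1 < p ->
  (\sum_(j < n) s j) `^ p <= n%:R `^ (p - 1) * \sum_(j < n) s j `^ p.
Proof.
move=> s0 p1; have p0 : p != 0 by rewrite gt_eqF //; lra.
set a := \sum_(j < n) s j.
have a0 : 0 <= a by exact: sumr_ge0.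
have [->|aN0] := eqVneq a 0.
  by rewrite powR0 // mulr_ge0 ?powR_ge0 // sumr_ge0 // => j _; exact: powR_ge0.
have n0 : (0 < n)%N.
  by rewrite lt0n; apply: contraNneq aN0 => n0; rewrite /a n0 big_ord0.
have nR : 0 < n%:R :> R by rewrite ltr0n.
pose mu := a / n%:R.
have mu0 : 0 < mu by rewrite divr_gt0 // lt_neqAle eq_sym aN0.
have tan (j : 'I_n) : mu `^ p * (p * (s j / mu) - (p - 1)) <= s j `^ p.
  have sE : s j = mu * (s j / mu) by rewrite mulrCA divff ?gt_eqF ?mulr1.
  have sm0 : 0 <= s j / mu by rewrite divr_ge0 // ltW.
  rewrite [in leRHS]sE powRM // ?(ltW mu0) // ler_wpM2l ?powR_ge0 //.
  exact: powR_ge_tangent.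
have : \sum_(j < n) mu `^ p * (p * (s j / mu) - (p - 1)) <=
    \sum_(j < n) s j `^ p by apply: ler_sum.
rewrite -mulr_sumr big_split /= -mulr_sumr -mulr_suml -/a sumr_const card_ord.
have -> : a / mu = n%:R by rewrite /mu; field; rewrite aN0 gt_eqF.
rewrite -[(- (p - 1)) *+ n]mulr_natr => H.
have {H} : mu `^ p * n%:R <= \sum_(j < n) s j `^ p.
  by apply: le_trans H; rewrite ler_wpM2l ?powR_ge0 //; lra.
have nn0 : n%:R `^ (p - 1) != 0 :> R by rewrite gt_eqF // powR_gt0.
have n1 : n%:R `^ p = n%:R `^ (p - 1) * n%:R :> R.
  by rewrite -{3}(@powRr1 _ n%:R) ?ltW // -powRD ?subrK // (gt_eqF nR) implybT.
have -> : a `^ p = n%:R `^ (p - 1) * (mu `^ p * n%:R).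
  have -> : a = mu * n%:R by rewrite /mu divfK // gt_eqF.
  by rewrite powRM ?ltW // n1 mulrCA.
by move=> H; rewrite ler_pM2l ?powR_gt0.
Qed.

(** Reduces bounds on the extended-real norm to real finite sums. *)
Lemma lp_norm_leP s p M : 0 < p -> 0 <= M ->
  (poweR (\sum_(0 <= j <oo) (s j `^ p)%:E) p^-1 <= M%:E)%E <->
  forall n, \sum_(j < n) s j `^ p <= M `^ p.
Proof.
move=> p0 M0; have pN0 : p != 0 by rewrite gt_eqF.
have s0 j : (0 <= j)%N -> true -> (0 <= (s j `^ p)%:E)%E.
  by rewrite lee_fin powR_ge0.
have S0 : (0 <= \sum_(0 <= j <oo) (s j `^ p)%:E)%E.
  by apply: nneseries_ge0 => j _ _; rewrite lee_fin powR_ge0.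
have iv (x : \bar R) : (0 <= x)%E -> x \in `[0%E, +oo%E].
  by rewrite in_itv /= leey andbT.
split => [SM n|SM].
  rewrite -lee_fin -sumEFin -(big_mkord predT (fun j => (s j `^ p)%:E)).
  apply: le_trans (nneseries_lim_ge n s0) _.
  rewrite -poweR_EFin -[leLHS]poweRe1 // -(mulVf pN0) poweRrM.
  by apply: gt0_ler_poweR => //; rewrite ?iv ?poweR_ge0 ?lee_fin // ltW.
have -> : M%:E = poweR (M `^ p)%:E p^-1.
  by rewrite poweR_EFin -powRrM mulfV // powRr1.
apply: gt0_ler_poweR; rewrite ?iv ?lee_fin ?powR_ge0 ?invr_ge0 ?(ltW p0) //.
apply: lime_le; first exact: is_cvg_nneseries.
by apply: nearW => n; rewrite big_mkord sumEFin lee_fin.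
Qed.

(** Index 0 belongs to the initial segment, index k + 1 to the block from m^(2^k) to m^(2^(k+1)). *)
Definition block_weight (k : nat) : R :=
  if k is k'.+1 then expR (- (2 ^+ k' / 8)) else 1.

Lemma block_weight_ge0 k : 0 <= block_weight k.
Proof. by case: k => // k; exact: expR_ge0. Qed.

(* On the block m^(2^k) <= j < m^(2^(k+1)) one has
   s_j ^ p <= s_j * (A (k+1) / m^(2^k)) ^ (p - 1), to be summed over j. *)
Lemma sum_powR_blocks s p m M :
  (forall j, 0 <= s j) -> {homo s : i j / (i <= j)%N >-> j <= i} ->
  1 < p <= 2 -> 4^-1 <= (p - 1) * ln m%:R ->
  (forall K, \sum_(k < K) block_weight k * \sum_(j < m ^ (2 ^ k)) s j <= M) ->
  forall n, \sum_(j < n) s j `^ p <= M `^ p.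
Proof.
move=> s0 s_dec /andP[p1 p2] pm AM n.
have p0 : 0 < p by lra.
have m2 : (1 < m)%N.
  rewrite ltnNge; apply/negP => m1; suff : ln m%:R <= 0 :> R by nra.
  by rewrite ln_le0 // lern1.
have mR : 0 < m%:R :> R by rewrite ltr0n ltnW.
pose A k := \sum_(j < m ^ (2 ^ k)) s j.
have A0 k : 0 <= A k by exact: sumr_ge0.
pose x k := block_weight k * A k.
have x0 k : 0 <= x k by rewrite mulr_ge0 ?block_weight_ge0.
have xM K : \sum_(k < K) x k <= M by exact: AM.
have M0 : 0 <= M by have := xM 0%N; rewrite big_ord0.
have blocks K : \sum_(j < m ^ (2 ^ K)) s j `^ p <= \sum_(k < K.+1) x k `^ p.
  elim: K => [|K IH].
    rewrite big_ord1 /x mul1r.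
    rewrite -(mulr_powRB1 (A0 _) p0) {1}/A mulr_suml; apply: ler_sum => j _.
    rewrite -mulr_powRB1 //.
    rewrite ler_wpM2l // ge0_ler_powR ?nnegrE //; first by lra.
    by rewrite /A (bigD1 j) //= lerDl sumr_ge0.
  have mK0 : 0 < (m ^ 2 ^ K)%:R :> R by rewrite ltr0n expn_gt0 (ltnW m2).
  have mm : (m ^ 2 ^ K <= m ^ 2 ^ K.+1)%N by rewrite leq_exp2l // leq_exp2l.
  rewrite -!(big_mkord predT (fun j => s j `^ p)).
  rewrite (big_cat_nat (n := m ^ 2 ^ K)) //= big_mkord big_ord_recr /=.
  rewrite lerD //.
  (* By monotonicity s_j is at most the mean of the first m^(2^K) terms. *)
  have tail j : (m ^ 2 ^ K <= j)%N -> s j <= A K.+1 / (m ^ 2 ^ K)%:R.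
    move=> Kj; rewrite ler_pdivlMr // mulr_natr.
    apply: (@le_trans _ _ (\sum_(i < m ^ 2 ^ K) s i)).
      rewrite -[in leLHS](card_ord (m ^ 2 ^ K)) -sumr_const ler_sum // => i _.
      by rewrite s_dec // (leq_trans _ Kj) // ltnW.
    rewrite /A -!(big_mkord predT s) [leRHS](big_cat_nat (n := m ^ 2 ^ K)) //=.
    by rewrite lerDl sumr_ge0.
  have xE : x K.+1 `^ p = expR (- (2 ^+ K / 8)) `^ p * (A K.+1 * A K.+1 `^ (p - 1)).
    by rewrite /x powRM ?expR_ge0 // mulr_powRB1.
  apply: (@le_trans _ _ (A K.+1 * (A K.+1 / (m ^ 2 ^ K)%:R) `^ (p - 1))).
    apply: (@le_trans _ _ (\sum_(m ^ 2 ^ K <= j < m ^ 2 ^ K.+1)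
        s j * (A K.+1 / (m ^ 2 ^ K)%:R) `^ (p - 1))).
      apply: ler_sum_nat => j /andP[Kj _]; rewrite -mulr_powRB1 //.
      rewrite ler_wpM2l // ge0_ler_powR ?nnegrE ?tail //; first by lra.
      by rewrite divr_ge0 // ltW.
    rewrite -mulr_suml ler_wpM2r ?powR_ge0 //.
    rewrite /A -(big_mkord predT s) [leRHS](big_cat_nat (n := m ^ 2 ^ K)) //=.
    by rewrite lerDr sumr_ge0.
  (* Origin of the 8: from (p - 1) ln m >= 1/4 and p <= 2 one gets 2^K (p - 1) ln m >= 2^K / 4 >= p
     2^K / 8. *)
  have key : (m ^ 2 ^ K)%:R^-1 `^ (p - 1) <= expR (- (2 ^+ K / 8)) `^ p.
    have -> : (m ^ 2 ^ K)%:R = expR (2 ^+ K * ln m%:R) :> R.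
      by rewrite -natrX expRM_natl lnK ?posrE // natrX.
    rewrite -expRN -!expRM ler_expR.
    by have : 0 < 2 ^+ K :> R by []; nra.
  rewrite xE powRM ?invr_ge0 ?(ltW mK0) // mulrA mulrC.
  by rewrite ler_wpM2r // mulr_ge0 ?powR_ge0.
have nm : (n <= m ^ 2 ^ n)%N.
  by rewrite ltnW // (ltn_trans (ltn_expl n (ltnSn 1))) // ltn_expl.
apply: (@le_trans _ _ (\sum_(k < n.+1) x k `^ p)).
  apply: le_trans (blocks n).
  rewrite -!(big_mkord predT (fun j => s j `^ p)).
  rewrite [leRHS](big_cat_nat (n := n)) //= lerDl sumr_ge0 // => j _.
  exact: powR_ge0.
(* The p-norm of [x] is at most its 1-norm, since each [x k] is at most [M]. *)
rewrite -(mulr_powRB1 M0 p0).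
apply: (@le_trans _ _ (\sum_(k < n.+1) x k * M `^ (p - 1))).
  apply: ler_sum => k _; rewrite -mulr_powRB1 // ler_wpM2l //.
  rewrite ge0_ler_powR ?nnegrE //; first by lra.
  by apply: le_trans (xM n.+1); rewrite (bigD1 k) //= lerDl sumr_ge0.
by rewrite -mulr_suml ler_wpM2r ?powR_ge0.
Qed.

End SequenceNorms.

(** * The exponents p(n) and the decay of the weights *)

Section Exponents.
Context {R : realType}.
Implicit Types (s : nat -> R) (M : R).

Lemma pexp_sub1 n : pexp R n - 1 = (1 + 2 * ln n.+1%:R)^-1.
Proof.
have l0 : 0 <= ln n.+1%:R :> R by rewrite ln_ge0 // ler1n.
rewrite /pexp lnM ?posrE ?expR_gt0 ?ltr0n // expRK.
by field; rewrite gt_eqF //; lra.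
Qed.

Lemma pexp_gt1_le2 n : 1 < pexp R n <= 2.
Proof.
have l0 : 0 <= ln n.+1%:R :> R by rewrite ln_ge0 // ler1n.
have : (1 + 2 * ln n.+1%:R)^-1 <= 1 :> R by rewrite invf_le1; lra.
have : 0 < (1 + 2 * ln n.+1%:R)^-1 :> R by rewrite invr_gt0; lra.
by rewrite -pexp_sub1 => ? ?; apply/andP; split; lra.
Qed.

(** For [n > 0] this is L / (1 + 2 L) with L = ln (n + 1) >= ln 2 >= 1/2. For [n = 0] the exponent
    is 2 and the product is ln 2. *)
Lemma pexp_ln_ge n : 4^-1 <= (pexp R n - 1) * ln (maxn 2 n.+1)%:R.
Proof.
have l2 : 2^-1 <= ln 2 :> R.
  rewrite -ler_expR lnK ?posrE // -lef_pV2 ?posrE ?expR_gt0 // -expRN.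
  by apply: le_trans (expR_ge1Dx _); lra.
rewrite pexp_sub1; case: n => [|n].
  by rewrite ln1 mulr0 addr0 invr1 mul1r; lra.
have -> : maxn 2 n.+2 = n.+2 by exact/maxn_idPr.
have ln2 : 2^-1 <= ln n.+2%:R :> R.
  by apply: le_trans l2 _; rewrite ler_ln ?posrE ?ltr0n // ler_nat.
rewrite mulrC ler_pdivlMr; lra.
Qed.

(** The left side is exp(L / (1 + 2 L)) with L = ln (n + 1), hence at most e. The p-th power on the
    right turns into the constant e after taking roots. *)
Lemma powR_pexp_le n : n.+1%:R `^ (pexp R n - 1) <= expR 1 `^ pexp R n.
Proof.
have l0 : 0 <= ln n.+1%:R :> R by rewrite ln_ge0 // ler1n.
have /andP[p1 _] := pexp_gt1_le2 n.
rewrite -{1}(@lnK _ n.+1%:R) ?posrE ?ltr0n // -!expRM ler_expR mul1r.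
apply: (@le_trans _ _ 1); last exact: ltW.
by rewrite pexp_sub1 ler_pdivrMr; lra.
Qed.

Lemma sum_le_lp_norm s n M : (forall j, 0 <= s j) -> 0 <= M ->
  (poweR (\sum_(0 <= j <oo) (s j `^ pexp R n)%:E) (pexp R n)^-1 <= M%:E)%E ->
  \sum_(j < n.+1) s j <= expR 1 * M.
Proof.
move=> s0 M0; have /andP[p1 _] := pexp_gt1_le2 n.
have p0 : 0 < pexp R n by lra.
move=> /(lp_norm_leP s _ _ p0 M0)/(_ n.+1) sM.
have : (\sum_(j < n.+1) s j) `^ pexp R n <= (expR 1 * M) `^ pexp R n.
  apply: le_trans (powR_sum_le s _ _ s0 p1) _; rewrite powRM ?expR_ge0 //.
  apply: ler_pM; rewrite ?powR_ge0 ?powR_pexp_le ?sM //.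
  by rewrite sumr_ge0 // => j _; exact: powR_ge0.
apply: contraTT; rewrite -!ltNge => H.
by rewrite gt0_ltr_powR ?nnegrE ?mulr_ge0 ?expR_ge0 ?sumr_ge0.
Qed.

(* The base n + 1 = 1 is replaced by 2, since the powers of 1 do not tend to
   infinity. *)
Lemma lp_norm_le_blocks s n M :
  (forall j, 0 <= s j) -> {homo s : i j / (i <= j)%N >-> j <= i} ->
  (forall K, \sum_(k < K)
     block_weight k * \sum_(j < maxn 2 n.+1 ^ (2 ^ k)) s j <= M) ->
  (poweR (\sum_(0 <= j <oo) (s j `^ pexp R n)%:E) (pexp R n)^-1 <= M%:E)%E.
Proof.
move=> s0 s_dec sM.
have /andP[p1 _] := pexp_gt1_le2 n.
apply/lp_norm_leP; [by lra|by have := sM 0%N; rewrite big_ord0|].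
exact: (@sum_powR_blocks R s _ _ M s0 s_dec (pexp_gt1_le2 n) (pexp_ln_ge n) sM).
Qed.

(** With D <= 2^q the power D^(k+1) is at most 2^q (2^k)^q, and y^q <= q! exp(y) is applied to y =
    2^k / 8. *)
Lemma block_weight_decay (D : R) : 0 <= D ->
  exists2 B, 0 <= B & forall k, block_weight k * D ^+ k <= B.
Proof.
move=> D0; pose q := (Num.bound D).+1.
have Dq : D <= 2 ^+ q.
  rewrite (le_trans (ltW (archi_boundP D0))) // -natrX ler_nat.
  by rewrite (leq_trans (leqnSn _)) // ltnW // ltn_expl.
have B0 : 0 <= 2 ^+ q * (8 ^+ q * q`!%:R) :> R.
  by apply: mulr_ge0; [|apply: mulr_ge0]; rewrite ?exprn_ge0.
exists (1 + 2 ^+ q * (8 ^+ q * q`!%:R)); first exact: addr_ge0.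
case=> [|k]; first by rewrite /= mul1r expr0 lerDl.
apply: ler_wpDl => //; rewrite /= expRN ler_pdivrMl ?expR_gt0 //.
have y0 : 0 <= 2 ^+ k / 8 :> R by rewrite divr_ge0.
have yq : (2 ^+ k / 8) ^+ q <= q`!%:R * expR (2 ^+ k / 8) :> R.
  rewrite [leRHS]mulrC -ler_pdivrMr ?ltr0n ?fact_gt0 //.
  by apply: le_trans (expR_ge1Dxn (Num.bound D) y0); rewrite lerDr.
apply: (@le_trans _ _ (2 ^+ q * (2 ^+ k) ^+ q)).
  rewrite -exprMn -exprS -exprM mulnC exprM.
  by rewrite lerXn2r ?nnegrE // exprn_ge0.
have -> : (2 ^+ k) ^+ q = 8 ^+ q * (2 ^+ k / 8) ^+ q :> R.
  by rewrite -exprMn mulrC divfK.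
rewrite [leRHS]mulrCA ler_wpM2l ?exprn_ge0 // [leRHS]mulrCA.
by rewrite ler_wpM2l ?exprn_ge0 // [leRHS]mulrC.
Qed.

End Exponents.

(** * Coordinates, dilations and norms in a sequence lattice *)

Section SequenceLattices.
Context {R : realType}.
Variable F : banachSeqLattice R.
Implicit Types (f g : F) (n k : nat).
Local Notation coord := Defs.coord (only parsing).

Lemma coordZ c f n : coord F (c *: f) n = c * coord F f n.
Proof. by rewrite linearZ. Qed.

Lemma coord_unit f n : coord F f n != 0 ->
  exists e : F, coord F e = fun i => (i == n)%:R.
Proof.
move=> fn; pose a i : R := (i == n)%:R * coord F f n.
have [|g ga _] := @bsl_solid _ F f a.
  move=> i; rewrite /a; case: eqVneq => [->|_]; first by rewrite mul1r.
  by rewrite mul0r normr0.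
exists ((coord F f n)^-1 *: g); apply/funext => i.
by rewrite coordZ ga /a mulrCA mulVf ?mulr1.
Qed.

(** If the unit sequence [e] at [n] lies in F, solidity bounds the norm of f_n e by that of f;
    otherwise the coordinate vanishes on F. *)
Lemma coord_bounded n :
  exists2 C : R, 0 <= C & forall f, `|coord F f n| <= C * `|f|.
Proof.
have [[f0 f0n]|no] := pselect (exists f, coord F f n != 0); last first.
  exists 0 => // f; rewrite mul0r; have [->|fn] := eqVneq (coord F f n) 0.
    by rewrite normr0.
  by case: no; exists f.
have [e eE] := coord_unit _ _ f0n.
have e0 : 0 < `|e|.
  rewrite normr_gt0; apply/eqP => e0.
  have : coord F e n = 1 by rewrite eE eqxx.
  by rewrite e0 linear0 => /esym/eqP; rewrite oner_eq0.
exists `|e|^-1; first by rewrite invr_ge0.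
move=> f; rewrite mulrC ler_pdivlMr // -normrZ.
have [|g ga] := @bsl_solid _ F f (coord F (coord F f n *: e)).
  move=> i; rewrite coordZ eE.
  case: eqVneq => [->|_]; first by rewrite mulr1.
  by rewrite mulr0 normr0.
by rewrite (coord_inj ga).
Qed.

Lemma square_dilation_iter : square_dilation_bounded F ->
  exists2 C : R, 0 <= C & forall f k,
    exists2 g, (forall n, coord F g n = coord F f (n.+1 ^ (2 ^ k)).-1) &
      `|g| <= C ^+ k * `|f|.
Proof.
(* The constant [C0] comes without a sign. *)
move=> [C0 SC]; exists `|C0| => // f; elim=> [|k [g gE gC]].
  by exists f => [n|]; rewrite ?expr0 ?mul1r.
have [h hE hC] := SC g; exists h => [n|].
  rewrite hE /square_dilation gE prednK ?expn_gt0 //.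
  by rewrite -expnM -expnS.
apply: le_trans hC _; rewrite exprS -mulrA.
apply: (@le_trans _ _ (`|C0| * `|g|)); first by rewrite ler_wpM2r // ler_norm.
by rewrite ler_wpM2l.
Qed.

(** The witness is the sum in F of the weighted iterates S^k f, which converges absolutely;
    continuity of the coordinates identifies its terms. *)
Lemma dilation_series : square_dilation_bounded F ->
  exists2 K : R, 0 <= K & forall f, (forall n, 0 <= coord F f n) ->
    exists2 g, (forall n m,
        \sum_(k < m) block_weight k * coord F f (n.+1 ^ (2 ^ k)).-1
          <= coord F g n) &
      `|g| <= K * `|f|.
Proof.
move=> /square_dilation_iter[C C0 SC].
(* The extra factor 2 leaves a geometric majorant of ratio 1/2. *)
have [|B B0 BC] := @block_weight_decay R (2 * C); first by rewrite mulr_ge0.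
exists (B * 2); first by rewrite mulr_ge0.
move=> f f0; have /choice[Sf SfE] : forall k, exists g,
    (forall n, coord F g n = coord F f (n.+1 ^ (2 ^ k)).-1) /\
    `|g| <= C ^+ k * `|f|.
  by move=> k; have [g gE gC] := SC f k; exists g.
pose u : nat -> F := fun k => block_weight k *: Sf k.
have half : `|2^-1 : R| < 1 by rewrite ger0_norm; lra.
have uB k : `|u k| <= geometric (B * `|f|) 2^-1 k.
  rewrite normrZ ger0_norm ?block_weight_ge0 //=.
  apply: (@le_trans _ _ (block_weight k * (C ^+ k * `|f|))).
    by rewrite ler_wpM2l ?block_weight_ge0 //; case: (SfE k).
  rewrite exprVn mulrA [leRHS]mulrAC ler_wpM2r //.
  by rewrite ler_pdivlMr ?exprn_gt0 // -mulrA -exprMn [C * 2]mulrC.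
have gc := @is_cvg_geometric_series R (B * `|f|) _ half.
have nc : cvgn [normed series u].
  apply: series_le_cvg gc => [n|n|//]; first exact: normr_ge0.
  exact: le_trans (normr_ge0 _) (uB n).
have uc := normed_cvg nc.
exists (limn (series u)); last first.
  apply: le_trans (lim_series_norm nc) _.
  have -> : B * 2 * `|f| = limn (series (geometric (B * `|f|) 2^-1)).
    rewrite (cvg_lim _ (cvg_geometric_series half)) //.
    by field.
  exact: lim_series_le.
(* Partial sums increase with [m], so a late one, close to the limit in norm, suffices; [D + 1]
   avoids dividing by 0. *)
move=> n m; have [D D0 cD] := coord_bounded n.
apply/ler_addgt0Pr => e e0.
have De : 0 < e / (D + 1) by rewrite divr_gt0 // ltr_wpDl.
have [N _ HN] := @cvgr_dist_lt _ _ _ _ _ _ _ uc _ De.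
have := HN (maxn N m) (leq_maxl _ _).
set M := maxn N m; set g := limn _ => gM.
have coordS i : coord F (series u i) n =
    \sum_(k < i) block_weight k * coord F f (n.+1 ^ (2 ^ k)).-1.
  rewrite /series /= big_mkord linear_sum fct_sumE; apply: eq_bigr => k _.
  by rewrite coordZ (SfE k).1.
apply: (@le_trans _ _ (coord F (series u M) n)).
  rewrite coordS -!(big_mkord predT (fun k => _ k * coord F f (n.+1 ^ (2 ^ k)).-1)).
  rewrite [leRHS](big_cat_nat (n := m)) ?leq_maxr //= lerDl sumr_ge0 // => k _.
  by rewrite mulr_ge0 ?block_weight_ge0.
rewrite -lerBlDl.
apply: le_trans (_ : `|coord F (g - series u M) n| <= e).
  by rewrite linearB /= -normrN opprB ler_norm.
apply: le_trans (cD _) _.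
apply: (@le_trans _ _ (D * (e / (D + 1)))); first by rewrite ler_wpM2l // ltW.
by rewrite mulrCA ger_pMr // ler_pdivrMr; lra.
Qed.

(* The coordinate with index 0, at which square dilation is the identity, is
   dominated by the one with index 1. *)
Lemma block_sums_dominated : square_dilation_bounded F ->
  exists2 K : R, 0 < K & forall f, (forall n, 0 <= coord F f n) ->
    (coord F f 0 = 0 -> f = 0) ->
    exists2 g, (forall n m, \sum_(k < m)
        block_weight k * coord F f (maxn 2 n.+1 ^ (2 ^ k)).-1 <= coord F g n) &
      `|g| <= K * `|f|.
Proof.
move=> /dilation_series[K K0 HK].
have [[f1 f10]|no] := pselect (exists f, coord F f 0 != 0); last first.
  exists 1 => // f f0 f00.
  have -> : f = 0.
    by apply: f00; apply/eqP/negPn/negP => fn; apply: no; exists f.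
  exists 0; rewrite ?normr0 ?mulr0 // => n m.
  by rewrite linear0 big1 // => k _; rewrite mulr0.
have [e eE] := coord_unit _ _ f10.
have [D D0 cD] := coord_bounded 1.
exists (K * (1 + D * `|e|) + 1).
  by rewrite ltr_wpDl // mulr_ge0 // addr_ge0 // mulr_ge0.
move=> f f0 _; have [g gE gK] := HK f f0.
have g0 n : 0 <= coord F g n by have := gE n 0%N; rewrite big_ord0.
(* Indices 0 and 1 share the base 2, so adding g_1 at index 0 bounds the sums there. *)
exists (g + coord F g 1 *: e) => [n m|].
  have -> : coord F (g + coord F g 1 *: e) n =
      coord F g n + coord F g 1 * (n == 0)%:R.
    by rewrite linearD linearZ eE.
  case: n => [|n]; first by rewrite mulr1 (le_trans (gE 1%N m)) // lerDr.
  have -> : maxn 2 n.+2 = n.+2 by exact/maxn_idPr.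
  by rewrite mulr0 addr0.
apply: le_trans (ler_normD _ _) _; rewrite normrZ.
apply: (@le_trans _ _ (`|g| * (1 + D * `|e|))).
  by rewrite mulrDr mulr1 lerD2l mulrCA mulrA ler_wpM2r.
rewrite mulrDl mul1r ler_wpDr // mulrAC ler_wpM2r //.
by rewrite addr_ge0 // mulr_ge0.
Qed.

(** When [a] is not in F the premise is vacuous and the right side is +oo. *)
Lemma bsl_norm_le (C : R) (a b : nat -> \bar R) : 0 < C ->
  (forall f, (forall n, (coord F f n)%:E = a n) ->
    exists2 g, (forall n, (coord F g n)%:E = b n) & `|g| <= C * `|f|) ->
  (bsl_norm F b <= C%:E * bsl_norm F a)%E.
Proof.
move=> C0 ab; rewrite /bsl_norm -ereal_inf_pZl //.
apply: le_ereal_inf_tmp => _ [_ [f fa <-] <-].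
have [g gb gC] := ab f fa.
by apply: ge_ereal_inf; exists `|g|%:E; [exists g|rewrite lee_fin].
Qed.

End SequenceLattices.

(** * Comparison of the two norms and the theorem *)

Section SumsAndSchattenNorms.
Context {R : realType} {H : completeNormedModType R[i]}.
Variable ip : {dot H for Num.conj}.
Hypothesis ip_norm : forall x : H, `|x| ^+ 2 = ip x x.
Variable F : banachSeqLattice R.
Implicit Types T : H -> H.
Local Notation coord := Defs.coord (only parsing).

Lemma bsl_norm_sum_le_schatten T :
  (bsl_norm F (fun n => (snum_sum ip T n)%:E) <=
    (expR 1)%:E * bsl_norm F (fun n => schatten ip (pexp R n) T))%E.
Proof.
apply: bsl_norm_le (expR_gt0 1) _ => f fE.
have f0 n : 0 <= coord F f n by rewrite -lee_fin fE poweR_ge0.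
have [|g gE gf] := @bsl_solid _ F (expR 1 *: f) (snum_sum ip T).
  move=> n; rewrite coordZ !ger0_norm ?mulr_ge0 ?expR_ge0 //; last first.
    by apply: sumr_ge0 => j _; exact: snum_ge0.
  apply: sum_le_lp_norm => // [j|]; first exact: snum_ge0.
  by rewrite fE.
exists g => [n|]; first by rewrite gE.
by apply: le_trans gf _; rewrite normrZ ger0_norm ?expR_ge0.
Qed.

Lemma bsl_norm_schatten_le_sum : square_dilation_bounded F ->
  exists2 K : R, 0 < K & forall T, bounded_op T ->
    (bsl_norm F (fun n => schatten ip (pexp R n) T) <=
      K%:E * bsl_norm F (fun n => (snum_sum ip T n)%:E))%E.
Proof.
move=> /block_sums_dominated[K K0 HK]; exists K => // T Tb.
have s0 := snum_ge0 ip T.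
have s_dec := snum_nonincreasing ip ip_norm T Tb.
apply: bsl_norm_le => // f fE.
have {}fE n : coord F f n = snum_sum ip T n by apply: EFin_inj.
have sum0 n : 0 <= snum_sum ip T n by apply: sumr_ge0 => j _; exact: s0.
have [n|f00|g gE gK] := HK f; first by rewrite fE.
  (* If the largest s-number vanishes, so do all of them. *)
  apply: coord_inj; apply/funext => n; rewrite linear0 fE.
  apply: big1 => j _; apply/eqP; rewrite eq_le s0 andbT.
  by rewrite (le_trans (s_dec 0%N j _)) // -f00 fE /snum_sum big_ord1.
have b_le n : (schatten ip (pexp R n) T <= (coord F g n)%:E)%E.
  apply: lp_norm_le_blocks => // k; apply: le_trans (gE n k).
  apply: ler_sum => i _; rewrite fE /snum_sum prednK // expn_gt0.
  by rewrite leq_max.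
have b0 n : (0 <= schatten ip (pexp R n) T)%E by exact: poweR_ge0.
(* Domination by [g] makes the Schatten norms finite, so solidity applies to them as a real
   sequence. *)
have b_fin n : schatten ip (pexp R n) T \is a fin_num.
  by rewrite ge0_fin_numE // (le_lt_trans (b_le n)) ?ltry.
have [|h hE hg] := @bsl_solid _ F g (fun n => fine (schatten ip (pexp R n) T)).
  move=> n; rewrite ger0_norm ?fine_ge0 //.
  by rewrite (le_trans _ (ler_norm _)) // -lee_fin fineK.
exists h => [n|]; first by rewrite hE fineK.
exact: le_trans gK.
Qed.

End SumsAndSchattenNorms.

(* T ranges over D: the choice D = X compares the norms on X only, the choice
   D = all compact operators also compares membership, with norm +oo off X. *)
Theorem theorem10 (R : realType)
    (H : completeNormedModType R[i]) (ip : {dot H for Num.conj})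
    (ip_norm : forall x : H, `|x| ^+ 2 = ip x x)
    (H_separable : separable H)
    (X : snIdeal ip) (F : banachSeqLattice R)
    (S_bounded : square_dilation_bounded F)
    (D : set (H -> H))
    (X_D : range (sni_op X) `<=` D) (D_compact : D `<=` @compact_op R H) :
  equiv_on D (sni_norm X)
    (fun T => bsl_norm F (fun n => (snum_sum ip T n)%:E)) ->
  equiv_on D (sni_norm X)
    (fun T => bsl_norm F (fun n => schatten ip (pexp R n) T)).
Proof.
move=> [c [C [c0 C0 XE]]].
have [K K0 bK] := bsl_norm_schatten_le_sum ip ip_norm F S_bounded.
exists (c / K), (C * expR 1); split => [||T DT].
- exact: divr_gt0.
- by rewrite mulr_gt0 ?expR_gt0.
have [lo up] := XE T DT; have [Tb _] := D_compact T DT.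
split.
  apply: le_trans lo; rewrite EFinM -muleA lee_pmul2l ?lte_fin //.
  by rewrite lee_pdivrMl // bK.
apply: le_trans up _; rewrite EFinM -muleA lee_pmul2l ?lte_fin //.
exact: bsl_norm_sum_le_schatten.
Qed.
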